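(* Let $\Omega\subseteq\mathbb{R}^2$ be open and connected and let $u:\Omega\to\mathbb{R}^N$ be an immersion in $C^2(\Omega)^N$ which solves $Q_\infty u=0$ on $\Omega$. Then the rank of $S(Du^\top Du)$ is constant on $\Omega$ and equals either $0$ or $2$. If $\mathrm{rk}(S(Du^\top Du))=0$, then $u$ satisfies $$K(Du)\equiv 2,\qquad K_{PP}(Du):D^2u=0,$$ and the condition $K(Du)\equiv 2$ is equivalent to conformality: $Du^\top Du=\frac12|Du|^2I$. If $\mathrm{rk}(S(Du^\top Du))=2$, then $u$ satisfies $$K(Du)\equiv \mathrm{const.}>2,\qquad [Du]^\perp K_{PP}(Du):D^2u=0.$$
   Context: Here $n=2\le N$. Immersion: a $C^1$ map $u:\Omega\subseteq\mathbb{R}^n\to\mathbb{R}^N$ with $\mathrm{rk}(Du)=n$ everywhere. $Du=(D_iu_\alpha)$ is an $N\times n$ matrix. Repeated indices are summed. For $P\in\mathbb{R}^{N\times n}$, $|P|=\mathrm{tr}(P^\top P)^{1/2}$. Dilation function: $K(P)=|P|^2\det(P^\top P)^{-1/n}$ on $\{\det(P^\top P)>0\}$ (here $n=2$); $K_P$, $K_{PP}$ are its first and second derivatives, with components $K_{P_{\alpha i}}$, $K_{P_{\alpha i}P_{\beta j}}$. For an $N\times n$ matrix $A$, $[A]^\perp$ is the orthogonal projection of $\mathbb{R}^N$ onto the nullspace of $A^\top$. The operator $Q_\infty$ is $$(Q_\infty u)_\alpha=\big(K_{P_{\alpha i}}K_{P_{\beta j}}+K[K_P]^\perp_{\alpha\gamma}K_{P_{\gamma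 i}P_{\beta j}}\big)(Du)\,D^2_{ij}u_\beta .$$ $K_{PP}(Du):D^2u$ is the vector with components $K_{P_{\alpha i}P_{\beta j}}(Du)D^2_{ij}u_\beta$. Ahlfors operator: $S(A)=\frac12(A+A^\top)-\frac1n\mathrm{tr}(A)I$ for $A\in\mathbb{R}^{n\times n}$. *)

(* Defs.v *)
From mathcomp Require Import all_boot all_order all_algebra.
From mathcomp Require Import all_classical all_reals all_analysis.

Set Implicit Arguments.
Unset Strict Implicit.
Unset Printing Implicit Defensive.

Import Order.TTheory GRing.Theory Num.Theory.
Import numFieldNormedType.Exports.

Local Open Scope classical_set_scope.
Local Open Scope ring_scope.

(* Points of R^n and R^N are row vectors (as for the library's Jacobian).
   Gradients are N x n matrices, and vectors of R^N on which N x N matrices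
   act are columns. *)

Section Maps.
Context {R : realType} {n N : nat}.
Implicit Types (Omega : set 'rV[R]_n) (u : 'rV[R]_n -> 'rV[R]_N).

Definition C1_on Omega u : Prop :=
  forall x, Omega x -> differentiable u x /\ {for x, continuous (jacobian u)}.

Definition C2_on Omega u : Prop :=
  C1_on Omega u /\ forall i : 'I_n, C1_on Omega ('D_(delta_mx 0 i) u).

(* The library's Jacobian acts on row vectors from the right, hence the
   transpose: (Du u x) alpha i = D_i u_alpha (x). *)
Definition Du u (x : 'rV[R]_n) : 'M[R]_(N, n) := (jacobian u x)^T.

Definition D2 u (i j : 'I_n) (beta : 'I_N) (x : 'rV[R]_n) : R :=
  'D_(delta_mx 0 i) ('D_(delta_mx 0 j) u) x 0 beta.

Definition immersion Omega u : Prop :=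
  C1_on Omega u /\ forall x, Omega x -> \rank (Du u x) = n.

End Maps.

Section Dilation.
Context {R : realType} {n N : nat}.
Implicit Types P A : 'M[R]_(N, n).

Definition frob_norm P : R := Num.sqrt (\tr (P^T *m P)).

(* Meaningful on the open set where \det (P^T *m P) > 0; elsewhere powR takes
   default values. *)
Definition dilation P : R :=
  frob_norm P ^+ 2 * (\det (P^T *m P)) `^ (- (n%:R)^-1).

Definition dilation_P P : 'M[R]_(N, n) :=
  \matrix_(alpha, i) 'D_(delta_mx alpha i) (dilation : _ -> R) P.

Definition dilation_PP P (alpha : 'I_N) (i : 'I_n) (beta : 'I_N) (j : 'I_n) : R :=
  'D_(delta_mx beta j) (fun P' => dilation_P P' alpha i : R) P.

(* In row-vector form the nullspace of A^T is the row space of kermx A, and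
   kermx (kermx A)^T is its orthogonal complement. As proj_mx acts on rows from
   the right, we transpose to act on columns from the left. *)
Definition perp_proj A : 'M[R]_N :=
  (proj_mx (kermx A) (kermx (kermx A)^T))^T.

End Dilation.

Definition ahlfors {R : realType} {n : nat} (A : 'M[R]_n) : 'M[R]_n :=
  2^-1 *: (A + A^T) - (n%:R^-1 * \tr A)%:M.

Section Operator.
Context {R : realType} {n N : nat}.
Implicit Types (u : 'rV[R]_n -> 'rV[R]_N) (x : 'rV[R]_n).

Definition Q_infty u x : 'cV[R]_N :=
  \col_alpha \sum_(beta < N) \sum_(i < n) \sum_(j < n)
    (let P := Du u x in
     dilation_P P alpha i * dilation_P P beta j
     + dilation P * \sum_(gamma < N)
         perp_proj (dilation_P P) alpha gamma * dilation_PP P gamma i beta j)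
    * D2 u i j beta x.

Definition dilation_PP_D2 u x : 'cV[R]_N :=
  \col_alpha \sum_(beta < N) \sum_(i < n) \sum_(j < n)
    dilation_PP (Du u x) alpha i beta j * D2 u i j beta x.

End Operator.

(* Main.v *)
Require Import Defs.
From mathcomp Require Import all_boot all_order all_algebra.
From mathcomp Require Import all_classical all_reals all_analysis.
From mathcomp Require Import ring lra.
Set Implicit Arguments.
Unset Strict Implicit.
Unset Printing Implicit Defensive.
Import Order.TTheory GRing.Theory Num.Theory.
Import numFieldNormedType.Exports.
Local Open Scope classical_set_scope.
Local Open Scope ring_scope.

(** Write G = P^T P and S for the Ahlfors operator. The dilation of a matrix P
    with two columns of rank 2 is tr G / sqrt (det G), and differentiating it
    gives the factorization
<<
      K_P = 2 (det G)^(-3/2) P adj(G) S(G)       (dilation_PE)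
>>
    which governs the whole proof.

    The chain rule (is_derive_dilation_Du) identifies the first part of the
    operator Q_infty with K_P(Du) applied to the gradient g of the function
    K(Du). That vector lies in the column space of K_P(Du), while the second
    part of the operator lies in its orthogonal complement, so a solution
    annihilates both (perp_proj_split).

    The matrix S(G) is symmetric, traceless and of size 2, so it is either zero
    or invertible (rank_ahlfors). Where it is zero, K_P(Du) vanishes and hence
    so does g. Where it is invertible, K_P(Du) is injective by the
    factorization, and K_P(Du) g = 0 again forces g = 0. So K(Du) has zero
    gradient everywhere and is constant on the connected set Omega
    (connected_derive0_cst).

    As K^2 = 4 - 4 det S(G) / det G with det S(G) <= 0, we have K >= 2, with
    equality exactly when S(G) = 0, that is when P is conformal. The constancy
    of K(Du) therefore gives the constancy of the rank of S.

    It remains to read off the normal equations. If S = 0 then K_P = 0, the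
    projection on the complement of its column space is the identity, and
    K_PP : D^2 u = 0. In general the column space of K_P is contained in that of
    P, so that being annihilated by the projection attached to K_P implies being
    annihilated by the one attached to P (perp_proj_mull_eq0). *)

(** * Two-by-two matrices *)

Lemma ord2P (i : 'I_2) : i = 0 \/ i = 1.
Proof. by case: i => [[|[|//]] h]; [left|right]; apply/val_inj. Qed.

Lemma sum2 (V : zmodType) (F : 'I_2 -> V) : \sum_(i < 2) F i = F 0 + F 1.
Proof.
by rewrite !big_ord_recl big_ord0 addr0; congr (_ + F _); apply/val_inj.
Qed.

Lemma mxtrace2 (V : zmodType) (A : 'M[V]_2) : \tr A = A 0 0 + A 1 1.
Proof. exact: sum2. Qed.

Lemma det_mx22 (T : comPzRingType) (A : 'M[T]_2) :
  \det A = A 0 0 * A 1 1 - A 0 1 * A 1 0.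
Proof.
rewrite (expand_det_row A 0) !big_ord_recl big_ord0 /cofactor /= !det_mx11 !mxE.
rewrite addr0 /= expr0 expr1 mul1r mulN1r mulrN.
by congr (_ * A _ _ - A _ _ * A _ _); apply/val_inj.
Qed.

Lemma adj_mx22 (T : comPzRingType) (A : 'M[T]_2) :
  \adj A = \matrix_(i, j) (if i == j then \tr A - A i i else - A i j).
Proof.
apply/matrixP => i j; rewrite !mxE mxtrace2 /cofactor det_mx11 !mxE.
case: (ord2P i) => ->; case: (ord2P j) => -> /=.
- by rewrite expr0 mul1r [RHS]addrC addKr; congr (A _ _); apply/val_inj.
- by rewrite expr1 mulN1r; congr (- A _ _); apply/val_inj.
- by rewrite expr1 mulN1r; congr (- A _ _); apply/val_inj.
- rewrite -signr_odd expr0 mul1r addrK; congr (A _ _); exact/val_inj.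
Qed.

Section Ahlfors.
Context {R : realType}.

Lemma ahlfors_symE (A : 'M[R]_2) : A^T = A ->
  ahlfors A = A - (2^-1 * \tr A)%:M.
Proof.
by move=> AT; rewrite /ahlfors AT -[A in A + A]scale1r -scalerDl scalerA mulVf ?scale1r.
Qed.

(** In terms of the entries a, b, c of A, this number is ((a - c) / 2)^2 + b^2:
    a nonnegative quantity, whose vanishing forces a = c and b = 0. *)
Lemma det_ahlfors (A : 'M[R]_2) : A^T = A ->
  - \det (ahlfors A) = (\tr A ^+ 2 - 4 * \det A) / 4.
Proof.
move=> AT; have A10 : A 1 0 = A 0 1 by rewrite -[in LHS]AT mxE.
rewrite ahlfors_symE// !det_mx22 mxtrace2 !mxE /= A10.
by field.
Qed.

Lemma det_ahlfors_le0 (A : 'M[R]_2) : A^T = A -> \det (ahlfors A) <= 0.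
Proof.
move=> AT; rewrite -oppr_ge0 det_ahlfors// mxtrace2 det_mx22.
have -> : A 1 0 = A 0 1 by rewrite -[in LHS]AT mxE.
have := sqr_ge0 (A 0 0 - A 1 1); have := sqr_ge0 (A 0 1); nra.
Qed.

Lemma ahlfors_eq0 (A : 'M[R]_2) : A^T = A ->
  (ahlfors A = 0 <-> \det (ahlfors A) = 0).
Proof.
move=> AT; split=> [->|]; first by rewrite det0.
have A10 : A 1 0 = A 0 1 by rewrite -[in LHS]AT mxE.
rewrite ahlfors_symE// det_mx22 mxtrace2 !mxE /= A10 => d0.
have : ((A 0 0 - A 1 1) / 2) ^+ 2 + A 0 1 ^+ 2 = 0.
  by apply/eqP; rewrite -oppr_eq0 -[X in _ == X]d0; apply/eqP; by field.
move=> /eqP; rewrite paddr_eq0 ?sqr_ge0// !sqrf_eq0 mulf_eq0 invr_eq0 pnatr_eq0 orbF.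
rewrite subr_eq0 => /andP[/eqP a0 /eqP b0].
apply/matrixP => i j; rewrite !mxE.
by case: (ord2P i) => ->; case: (ord2P j) => -> /=; rewrite ?A10 ?a0 ?b0;
  by field.
Qed.

(** A traceless symmetric matrix of size 2 has opposite eigenvalues, so its rank
    is never 1. *)
Lemma rank_ahlfors (A : 'M[R]_2) : A^T = A ->
  \rank (ahlfors A) = if ahlfors A == 0 then 0%N else 2%N.
Proof.
move=> AT; case: eqP => [->|/(ahlfors_eq0 AT) /eqP d0]; first exact: mxrank0.
by apply: mxrank_unit; rewrite unitmxE unitfE.
Qed.

End Ahlfors.

(** * The orthogonal projection on the nullspace of a transpose *)

Section Projection.
Context {R : realType}.

Lemma mulmx_tr_eq0 n (v : 'rV[R]_n) : v *m v^T = 0 -> v = 0.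
Proof.
move=> /matrixP /(_ 0 0); rewrite !mxE => /eqP.
rewrite psumr_eq0 => [/allP v0|i _]; last by rewrite mxE -expr2 sqr_ge0.
apply/rowP => i; have /= := v0 i (mem_index_enum i).
by rewrite !mxE -expr2 sqrf_eq0 => /eqP.
Qed.

Lemma capmx_kermx_tr m n (A : 'M[R]_(m, n)) :
  (A :&: kermx A^T = 0)%MS.
Proof.
apply/eqP; rewrite -submx0; apply/row_subP => i.
set v := row i _; have : (v <= A :&: kermx A^T)%MS by exact: row_sub.
rewrite sub_capmx => /andP[/submxP[w vE] /sub_kermxP vA].
rewrite submx0; apply/eqP/mulmx_tr_eq0.
by rewrite [in v^T]vE trmx_mul mulmxA vA mul0mx.
Qed.

(** The two summands meet trivially, and their dimensions add up to n by the
    rank theorem. *)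
Lemma addsmx_kermx_tr m n (A : 'M[R]_(m, n)) :
  row_full (A + kermx A^T)%MS.
Proof.
rewrite /row_full mxrank_disjoint_sum ?capmx_kermx_tr//.
by rewrite mxrank_ker mxrank_tr subnKC// rank_leq_col.
Qed.

Lemma perp_projK N n (A : 'M[R]_(N, n)) :
  perp_proj A *m perp_proj A = perp_proj A.
Proof. by rewrite -trmx_mul proj_mx_proj// capmx_kermx_tr. Qed.

(** Both sides say that w lies in the column space of A: the nullspace of A^T and
    its orthogonal complement span everything, so w is killed by the projection
    exactly when it lies in that complement. The right-hand side depends on A
    through the nullspace alone, which lets projections attached to different
    matrices be compared. *)
Lemma perp_proj_eq0 N n p (A : 'M[R]_(N, n)) (w : 'M[R]_(N, p)) :
  perp_proj A *m w = 0 <-> kermx A *m w = 0.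
Proof.
set U := kermx A; set V := kermx U^T.
have UV : (U :&: V = 0)%MS by exact: capmx_kermx_tr.
have -> : perp_proj A *m w = (w^T *m proj_mx U V)^T.
  by rewrite trmx_mul trmxK.
have kE : U *m w = 0 <-> (w^T <= V)%MS.
  split => [Uw|/sub_kermxP/(congr1 trmx)]; last first.
    by rewrite trmx_mul !trmxK trmx0.
  by apply/sub_kermxP; rewrite -trmx_mul Uw trmx0.
rewrite kE; split=> [/(congr1 trmx)|wV]; last by rewrite proj_mx_0// trmx0.
rewrite trmxK trmx0 => w0.
rewrite -[w^T]subr0 -[X in _ - X]w0.
by apply: proj_mx_compl_sub; rewrite submx_full// addsmx_kermx_tr.
Qed.

(** The columns of A *m B are combinations of those of A, so orthogonality to the
    latter is the stronger condition. *)
Lemma perp_proj_mull_eq0 N n m p (A : 'M[R]_(N, n)) (B : 'M[R]_(n, m))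
    (w : 'M[R]_(N, p)) :
  perp_proj (A *m B) *m w = 0 -> perp_proj A *m w = 0.
Proof.
rewrite !perp_proj_eq0 => w0.
have /submxP[X ->] : (kermx A <= kermx (A *m B))%MS.
  by apply/sub_kermxP; rewrite mulmxA mulmx_ker mul0mx.
by rewrite -mulmxA w0 mulmx0.
Qed.

Lemma perp_proj0_eq0 N n p (w : 'M[R]_(N, p)) :
  perp_proj (0 : 'M[R]_(N, n)) *m w = 0 -> w = 0.
Proof.
rewrite perp_proj_eq0 => w0.
have /submxP[X X1] : (1%:M <= kermx (0 : 'M[R]_(N, n)))%MS.
  by apply/sub_kermxP; rewrite mulmx0.
by rewrite -[w]mul1mx X1 -mulmxA w0 mulmx0.
Qed.

(** The two terms lie in orthogonal subspaces, the column space of A and its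
    complement. *)
Lemma perp_proj_split N n p (A : 'M[R]_(N, n)) (g : 'M[R]_(n, p))
    (w : 'M[R]_(N, p)) :
  A *m g + perp_proj A *m w = 0 -> A *m g = 0 /\ perp_proj A *m w = 0.
Proof.
move=> Agw; suff w0 : perp_proj A *m w = 0 by move: Agw; rewrite w0 addr0.
rewrite -perp_projK -mulmxA; apply/perp_proj_eq0.
move/(congr1 (mulmx (kermx A))): Agw.
by rewrite mulmxDr mulmxA mulmx_ker mul0mx add0r mulmx0.
Qed.

End Projection.

(** * Gram matrices and the value of the dilation *)

Section Gram.
Context {R : realType}.

Lemma gram_sym m n (P : 'M[R]_(m, n)) : (P^T *m P)^T = P^T *m P.
Proof. by rewrite trmx_mul trmxK. Qed.

Lemma gram_form_gt0 m n (P : 'M[R]_(m, n)) (v : 'rV[R]_n) :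
  \rank P = n -> v != 0 -> 0 < (v *m (P^T *m P) *m v^T) 0 0.
Proof.
move=> rP v0; have -> : v *m (P^T *m P) *m v^T = (v *m P^T) *m (v *m P^T)^T.
  by rewrite trmx_mul trmxK !mulmxA.
rewrite lt0r; apply/andP; split; last first.
  by rewrite mxE sumr_ge0// => i _; rewrite [_^T _ _]mxE -expr2 sqr_ge0.
apply: contra v0 => /eqP q0; apply/eqP.
have /mulmx_tr_eq0 : v *m P^T *m (v *m P^T)^T = 0.
  by apply/matrixP => i j; rewrite !ord1 q0 mxE.
by move=> /eqP; rewrite mulmx_free_eq0 => [/eqP//|]; rewrite /row_free mxrank_tr rP.
Qed.

Lemma mxtrace_gram_ge0 m n (P : 'M[R]_(m, n)) : 0 <= \tr (P^T *m P).
Proof.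
rewrite sumr_ge0// => i _; rewrite mxE sumr_ge0// => j _.
by rewrite mxE -expr2 sqr_ge0.
Qed.

Lemma frob_normE m n (P : 'M[R]_(m, n)) : frob_norm P ^+ 2 = \tr (P^T *m P).
Proof. by rewrite sqr_sqrtr ?mxtrace_gram_ge0. Qed.

Lemma det_gram_gt0 m (P : 'M[R]_(m, 2)) : \rank P = 2%N -> 0 < \det (P^T *m P).
Proof.
move=> rP; rewrite det_mx22; set G := P^T *m P.
have GT : G^T = G by exact: gram_sym.
have G10 : G 1 0 = G 0 1 by rewrite -[in LHS]GT mxE.
have form (v : 'rV[R]_2) : v != 0 -> 0 < (v *m G *m v^T) 0 0 by exact: gram_form_gt0.
clearbody G.
have G00 : 0 < G 0 0.
  have /form : delta_mx 0 0 != 0 :> 'rV[R]_2.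
    by apply/eqP => /rowP/(_ 0)/eqP; rewrite !mxE/= oner_eq0.
  by rewrite -rowE trmx_delta -colE !mxE.
(* The form with matrix [a b; b c] takes the value a (a c - b^2) at the vector
   (- b, a). *)
have := form (\row_j (if j == 0 then - G 0 1 else G 0 0)).
have -> : (\row_j (if j == 0 then - G 0 1 else G 0 0) *m G *m
    (\row_j (if j == 0 then - G 0 1 else G 0 0))^T) 0 0 =
    G 0 0 * (G 0 0 * G 1 1 - G 0 1 * G 1 0).
  by rewrite !(mxE, sum2) /= G10; ring.
rewrite pmulr_rgt0//; apply; apply/eqP => /rowP/(_ 1).
by rewrite !mxE/= => G00'; rewrite G00' ltxx in G00.
Qed.

Lemma ahlfors_gram_eq0 m (P : 'M[R]_(m, 2)) :
  ahlfors (P^T *m P) = 0 <-> P^T *m P = (2^-1 * frob_norm P ^+ 2)%:M.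
Proof.
rewrite ahlfors_symE ?gram_sym// frob_normE.
by split=> GE; apply/eqP; [rewrite -subr_eq0|rewrite subr_eq0]; apply/eqP.
Qed.

Lemma dilationE m (P : 'M[R]_(m, 2)) :
  dilation P = \tr (P^T *m P) * (\det (P^T *m P)) `^ (- 2^-1).
Proof. by rewrite /dilation frob_normE. Qed.

(** The excess of K^2 over its minimum 4 measures the failure of conformality. *)
Lemma dilation_sqr m (P : 'M[R]_(m, 2)) : 0 < \det (P^T *m P) ->
  dilation P ^+ 2 = 4 - 4 * \det (ahlfors (P^T *m P)) / \det (P^T *m P).
Proof.
move=> d0; rewrite dilationE powRN powR12_sqrt ?ltW// exprMn exprVn sqr_sqrtr ?ltW//.
rewrite -[\det (ahlfors _)]opprK det_ahlfors ?gram_sym//.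
by field; rewrite gt_eqF.
Qed.

Lemma dilation_gt0 m (P : 'M[R]_(m, 2)) : 0 < \det (P^T *m P) -> 0 < dilation P.
Proof.
move=> d0; rewrite lt0r; apply/andP; split; last first.
  by rewrite dilationE mulr_ge0 ?powR_ge0// mxtrace_gram_ge0.
apply/eqP => K0; have := dilation_sqr d0; rewrite K0.
have : \det (ahlfors (P^T *m P)) / \det (P^T *m P) <= 0.
  by rewrite pmulr_lle0 ?invr_gt0// det_ahlfors_le0// gram_sym.
rewrite -mulrA; lra.
Qed.

Lemma dilation_ge2 m (P : 'M[R]_(m, 2)) : 0 < \det (P^T *m P) -> 2 <= dilation P.
Proof.
move=> d0; have K0 := dilation_gt0 d0.
rewrite -(@ler_pXn2r _ 2)// ?nnegrE ?(ltW K0)// dilation_sqr//.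
have : \det (ahlfors (P^T *m P)) / \det (P^T *m P) <= 0.
  by rewrite pmulr_lle0 ?invr_gt0// det_ahlfors_le0// gram_sym.
rewrite -mulrA; lra.
Qed.

Lemma dilation_eq2 m (P : 'M[R]_(m, 2)) : 0 < \det (P^T *m P) ->
  dilation P = 2 <-> ahlfors (P^T *m P) = 0.
Proof.
move=> d0; rewrite ahlfors_eq0 ?gram_sym//; have := dilation_sqr d0.
split=> [K2|D0].
  move: H; rewrite K2 => /eqP; rewrite -subr_eq0.
  have -> : 2 ^+ 2 - (4 - 4 * \det (ahlfors (P^T *m P)) / \det (P^T *m P)) =
      4 * \det (ahlfors (P^T *m P)) / \det (P^T *m P) by ring.
  by rewrite !mulf_eq0 invr_eq0 (gt_eqF d0) orbF pnatr_eq0 => /eqP.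
move: H; rewrite D0 mulr0 mul0r subr0 => K2.
by apply/eqP; rewrite -(@eqrXn2 _ 2) ?ltW ?dilation_gt0// K2; apply/eqP; ring.
Qed.

End Gram.

(** * The gradient of the dilation *)

(** Directional derivatives are derivatives of functions of one real variable,
    where the chain rule is at hand. *)
Lemma is_derive_line (R : realType) (V : normedModType R) (f : V -> R) (x v : V)
    (t df : R) :
  is_derive (t *: v + x) v f df <-> is_derive t 1 (fun s : R => f (s *: v + x)) df.
Proof.
have E : (fun h : R => h^-1 *: ((f \o shift (t *: v + x)) (h *: v) - f (t *: v + x)))
    = (fun h : R => h^-1 *: (((fun s : R => f (s *: v + x)) \o shift t) (h *: 1)
                     - f (t *: v + x))).
  by apply/funext => h; rewrite /= [h%:A]mulr1 scalerDl addrA.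
split=> -[dfx dfE]; split.
- by move: dfx; rewrite /derivable E.
- by move: dfE; rewrite /derive E.
- by rewrite /derivable E.
- by rewrite /derive E.
Qed.

Section DilationGradient.
Context {R : realType}.

(** K_P in factored form: the factor P on the left puts its columns in the column
    space of P and, when P has rank 2, the factor S(G) on the right makes it
    vanish exactly for conformal P. *)
Definition dilation_grad m (P : 'M[R]_(m, 2)) : 'M[R]_(m, 2) :=
  let G := P^T *m P in
  (2 * (\det G) `^ (- (3 / 2))) *: (P *m \adj G *m ahlfors G).

Lemma is_derive_gram m n (M : R -> 'M[R]_(m, n)) (E : 'M[R]_(m, n)) (t : R) i j :
  (forall a k, is_derive t 1 (fun s => M s a k : R) (E a k)) ->
  is_derive t 1 (fun s => ((M s)^T *m M s) i j : R)
    (((M t)^T *m E + E^T *m M t) i j).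
Proof.
move=> dM.
have -> : (fun s => ((M s)^T *m M s) i j) =
    \sum_a ((fun s => M s a i : R) * (fun s => M s a j : R)).
  by apply/funext => s; rewrite fct_sumE mxE; apply: eq_bigr => a _; rewrite mxE.
apply: is_derive_eq; rewrite !mxE -big_split/=.
by apply: eq_bigr => a _; rewrite !mxE /GRing.scale/= [M t a j * _]mulrC.
Qed.

(** Stated along an arbitrary curve of matrices, so that the same computation
    yields the partial derivatives of K (take a line) and the gradient of K(Du)
    (take the restriction of Du to a line). *)
Lemma is_derive_dilation m (M : R -> 'M[R]_(m, 2)) (E : 'M[R]_(m, 2)) (t : R) :
  0 < \det ((M t)^T *m M t) ->
  (forall a k, is_derive t 1 (fun s => M s a k : R) (E a k)) ->
  is_derive t 1 (fun s => dilation (M s) : R) (\tr ((dilation_grad (M t))^T *m E)).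
Proof.
move=> d0 dM; set G := fun s => (M s)^T *m M s.
have dG i j := is_derive_gram i j dM.
have dtr : is_derive t 1 (fun s => \tr (G s) : R) (2 * \tr ((M t)^T *m E)).
  rewrite (_ : (fun s => _) = (fun s => G s 0 0 : R) + (fun s => G s 1 1 : R)).
    apply: is_derive_eq; rewrite mxtrace2.
    set H := _ *m E; have -> : E^T *m M t = H^T by rewrite trmx_mul trmxK.
    by rewrite !mxE; ring.
  by apply/funext => s; rewrite mxtrace2.
have ddet : is_derive t 1 (fun s => \det (G s) : R)
    (2 * \tr (\adj (G t) *m ((M t)^T *m E))).
  rewrite (_ : (fun s => _) = (fun s => G s 0 0 : R) * (fun s => G s 1 1 : R)
      - (fun s => G s 0 1 : R) * (fun s => G s 1 0 : R)).
    apply: is_derive_eq.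
    set H := _ *m E; have -> : E^T *m M t = H^T by rewrite trmx_mul trmxK.
    have symG : (G t)^T = G t by exact: gram_sym.
    have G10 : G t 1 0 = G t 0 1 by rewrite -[in LHS]symG mxE.
    clearbody H; move: (G t) G10 => Gt G10.
    rewrite adj_mx22 !mxtrace2 /GRing.scale/= !(mxE, sum2)/= G10.
    by ring.
  by apply/funext => s; rewrite det_mx22.
have dpow := is_derive1_comp (is_derive1_powR (- 2^-1) d0) ddet.
rewrite (_ : (fun s => _) = (fun s => \tr (G s) : R) *
    ((fun x : R => x `^ (- 2^-1)) \o (fun s => \det (G s) : R))); last first.
  by apply/funext => s; rewrite dilationE.
apply: is_derive_eq => /=.
(* Both powers of det G are expressed through w = (det G)^(-3/2). *)
rewrite -/(G t) in d0 *; have -> : - 2^-1 - 1 = - (3 / 2) :> R by field.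
have -> : - 2^-1 = 1 + - (3 / 2) :> R by field.
rewrite powRD ?(gt_eqF d0) ?implybT// powRr1 ?ltW// /dilation_grad -/(G t).
move: (_ `^ _) => w.
rewrite [(_ *: _)^T]linearZ/= -scalemxAl mxtraceZ !trmx_mul -!mulmxA.
have symG : (G t)^T = G t by exact: gram_sym.
have G10 : G t 1 0 = G t 0 1 by rewrite -[in LHS]symG mxE.
rewrite (ahlfors_symE symG); move: (G t) (_ *m E) G10 => Gt H G10.
rewrite !mxtrace2 /GRing.scale/= adj_mx22 det_mx22 !(mxE, sum2)/= !mxtrace2.
rewrite G10.
by field.
Qed.

Lemma dilation_PE m (P : 'M[R]_(m, 2)) :
  0 < \det (P^T *m P) -> dilation_P P = dilation_grad P.
Proof.
move=> d0; apply/matrixP => a i; rewrite mxE.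
have /is_derive_line dE : is_derive (0 : R) (1 : R)
    (fun s : R => dilation (s *: delta_mx a i + P) : R)
    (\tr ((dilation_grad P)^T *m delta_mx a i)).
  have -> : dilation_grad P = dilation_grad (0 *: delta_mx a i + P).
    by rewrite scale0r add0r.
  apply: is_derive_dilation; first by rewrite scale0r add0r.
  move=> b k.
  rewrite (_ : (fun _ => _) = (@id R) * cst (delta_mx a i b k) + cst (P b k)).
    by apply: is_derive_eq; rewrite scaler0 addr0 add0r /GRing.scale/= mulr1.
  by apply/funext => s; rewrite !mxE.
move: dE; rewrite scale0r add0r => dE; rewrite derive_val.
rewrite /mxtrace (bigD1 i)//= big1 ?addr0 => [|j ji].
  rewrite mxE (bigD1 a)//= big1 ?addr0 => [|b ba].
    by rewrite !mxE !eqxx mulr1.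
  by rewrite !mxE (negPf ba) mulr0.
by rewrite mxE big1// => b _; rewrite !mxE (negPf ji) andbF mulr0.
Qed.

(** The chain rule for K(Du). The curve of the proof is made of directional
    derivatives of u, which agree with the Jacobian only on Omega; as Omega is
    open, this is enough. *)
Lemma is_derive_dilation_Du m (Omega : set 'rV[R]_2) (u : 'rV[R]_2 -> 'rV[R]_m)
    (x : 'rV[R]_2) (i : 'I_2) :
  open Omega -> C2_on Omega u -> Omega x -> 0 < \det ((Du u x)^T *m Du u x) ->
  is_derive x (delta_mx 0 i) (fun y => dilation (Du u y) : R)
    (\sum_b \sum_j dilation_P (Du u x) b j * D2 u i j b x).
Proof.
move=> oO [uC1 uC2] Ox d0.
set e := delta_mx 0 i.
pose M y : 'M[R]_(m, 2) := \matrix_(a, j) ('D_(delta_mx 0 j) u y) 0 a.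
have DuM y : Omega y -> Du u y = M y.
  move=> Oy; apply/matrixP => a j; rewrite !mxE deriveE//.
  exact: (uC1 _ Oy).1.
apply: (@near_eq_is_derive _ _ _ (fun y => dilation (M y) : R)).
  near=> y; rewrite DuM//; near: y; exact: open_nbhs_nbhs.
rewrite dilation_PE// DuM//; rewrite DuM// in d0.
have -> : x = 0 *: e + x by rewrite scale0r add0r.
apply/is_derive_line.
rewrite scale0r add0r.
apply: is_derive_eq.
  apply: (@is_derive_dilation _ (fun s => M (s *: e + x))
     (\matrix_(a, j) D2 u i j a x)).
    by rewrite scale0r add0r.
  move=> a k.
  apply/(@is_derive_line _ _ (fun y => M y a k)); rewrite scale0r add0r.
  have -> : (fun y => M y a k) = (fun y => ('D_(delta_mx 0 k) u y) 0 a).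
    by apply/funext => y; rewrite mxE.
  have dDu : derivable ('D_(delta_mx 0 k) u) x e.
    exact/diff_derivable/(uC2 k x Ox).1.
  rewrite mxE /D2 derive_mx// mxE; apply/derivableP.
  by have /derivable_mxP := dDu; apply.
rewrite /mxtrace exchange_big/= scale0r add0r.
by apply: eq_bigr => j _; rewrite mxE; apply: eq_bigr => b _; rewrite !mxE.
Unshelve. all: by end_near. Qed.

Lemma dilation_grad_eq0 m (P : 'M[R]_(m, 2)) : ahlfors (P^T *m P) = 0 ->
  dilation_grad P = 0.
Proof. by move=> S0; rewrite /dilation_grad S0 mulmx0 scaler0. Qed.

(** When S(G) is not zero it is invertible, and so is every factor of the gradient
    except P, which is injective. *)
Lemma dilation_grad_inj m p (P : 'M[R]_(m, 2)) (g : 'M[R]_(2, p)) : \rank P = 2%N ->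
  ahlfors (P^T *m P) <> 0 -> dilation_grad P *m g = 0 -> g = 0.
Proof.
move=> rP S0; have d0 := det_gram_gt0 rP; set G := P^T *m P.
have Su : ahlfors G \in unitmx.
  by rewrite unitmxE unitfE; apply/eqP => /(ahlfors_eq0 (gram_sym P)).
have Gu : G \in unitmx by rewrite unitmxE unitfE gt_eqF.
rewrite /dilation_grad -/G -scalemxAl => /eqP; rewrite scaler_eq0.
rewrite mulf_eq0 pnatr_eq0/= gt_eqF ?powR_gt0//= => /eqP; rewrite -!mulmxA => PASg.
(* P is injective because P^T P is invertible. *)
have ASg : \adj G *m (ahlfors G *m g) = 0.
  by rewrite -[LHS](mulKmx Gu) -[G *m _](mulmxA P^T P) PASg !mulmx0.
have : \det G *: (ahlfors G *m g) = 0.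
  by rewrite -mul_scalar_mx -mul_mx_adj -mulmxA ASg mulmx0.
move/eqP; rewrite scaler_eq0 gt_eqF//= => /eqP Sg.
by rewrite -[g](mulKmx Su) Sg mulmx0.
Qed.

End DilationGradient.

(** * Functions with zero gradient on a connected open set *)

Lemma derive0_eq_segment (R : realType) (f : R -> R) (a b : R) :
  (forall x, Num.min a b <= x <= Num.max a b -> is_derive x 1 f 0) -> f a = f b.
Proof.
wlog ab : a b / a <= b.
  move=> H fd; case: (leP a b) => [ab|/ltW ba]; first exact: H.
  by apply/esym/H => // x; rewrite minC maxC; exact: fd.
rewrite min_l// max_r// => fd.
have [||c _] := @MVT_segment R f (fun=> 0) a b ab.
- by move=> x /itvP xab; apply: fd; rewrite !xab.
- apply: derivable_within_continuous => x; rewrite in_itv/= => xab.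
  exact: (@ex_derive _ _ _ _ _ _ _ (fd x xab)).
- by rewrite mul0r => /eqP; rewrite subr_eq0 => /eqP.
Qed.

(** Balls of row vectors are boxes, so x can be joined to y inside the ball by
    changing one coordinate at a time. *)
Lemma derive0_eq_ball (R : realType) n (f : 'rV[R]_n -> R) (x y : 'rV[R]_n) (e : R) :
  (forall z i, ball x e z -> is_derive z (delta_mx 0 i) f 0) ->
  ball x e y -> f y = f x.
Proof.
move=> fd [e0 xy].
pose z k : 'rV[R]_n := \row_j (if (j < k)%N then y 0 j else x 0 j).
have -> : y = z n by apply/rowP => j; rewrite mxE ltn_ord.
have -> : x = z 0%N by apply/rowP => j; rewrite mxE.
suff zk k : (k <= n)%N -> f (z k) = f (z 0%N) by exact: zk.
elim: k => // k IH kn; rewrite -IH; last exact: ltnW.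
pose i := Ordinal kn; pose v : 'rV[R]_n := delta_mx 0 i.
have zE (s : R) : s *: v + z k = \row_j (if j == i then x 0 i + s else z k 0 j).
  apply/rowP => j; rewrite !mxE eqxx/=; case: eqP => [->|_].
    by rewrite ltnn mulr1 addrC.
  by rewrite mulr0 add0r.
have -> : z k.+1 = (y 0 i - x 0 i) *: v + z k.
  rewrite zE; apply/rowP => j; rewrite !mxE; case: eqP => [->|/eqP ji].
    by rewrite ltnSn addrC subrK.
  by rewrite ltnS leq_eqVlt -[j == k :> nat]/(j == i) (negPf ji).
have -> : f (z k) = f (0 *: v + z k) by rewrite scale0r add0r.
apply: (@derive0_eq_segment _ (fun s => f (s *: v + z k))) => s hs.
apply/(@is_derive_line _ _ f); apply: fd; rewrite zE; split=> [|o j]; first exact: e0.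
rewrite mxE ord1.
have := xy 0; rewrite /ball/= => xy0.
case: eqP => [->|_]; last by rewrite mxE; case: ifP => // _; rewrite subrr normr0.
rewrite opprD addNKr normrN; apply: le_lt_trans (xy0 i).
move: hs; case: (leP (y 0 i - x 0 i) 0) => h /andP[h1 h2].
  by rewrite ler0_norm// ger0_norm; lra.
by rewrite ger0_norm// distrC gtr0_norm.
Qed.

(** The level sets of a locally constant function are both open and closed in
    Omega. *)
Lemma connected_derive0_cst (R : realType) n (Omega : set 'rV[R]_n)
    (f : 'rV[R]_n -> R) :
  open Omega -> connected Omega ->
  (forall x i, Omega x -> is_derive x (delta_mx 0 i) f 0) ->
  forall x y, Omega x -> Omega y -> f y = f x.
Proof.
move=> oO cO fd x y Ox Oy.
have loc z : Omega z -> \forall w \near z, Omega w /\ f w = f z.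
  move=> Oz; have /nbhs_ballP[e /= e0 eO] := open_nbhs_nbhs (conj oO Oz).
  apply/nbhs_ballP; exists e => // w zw; split; first exact: eO.
  by apply: derive0_eq_ball zw => p i /eO; exact: fd.
have oB (Q : set R) : open (Omega `&` (f @^-1` Q)).
  rewrite openE => z [Oz Qz]; apply: filterS (loc z Oz) => w [Ow fw].
  by split => //=; rewrite fw.
suff: Omega y -> (Omega `&` [set z | f z = f x]) y by case/(_ Oy).
suff -> : Omega `&` [set z | f z = f x] = Omega by [].
apply: cO; first by exists x.
- exists (Omega `&` (f @^-1` [set f x])); first exact: oB.
  by rewrite setIA setIid.
- exists (~` (Omega `&` (f @^-1` (~` [set f x])))).
    by apply: open_closedC; exact: oB.
  apply/seteqP; split=> z /= [Oz]; first by move=> fz; split=> // -[_]; apply.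
  by move=> nz; split=> //; apply: contrapT => fz; apply: nz.
Qed.

(** * Solutions of the equation *)

(** The first summand is K_P(Du) applied to the gradient of K(Du), which
    is_derive_dilation_Du recognizes in this column of double sums. *)
Lemma Q_inftyE (R : realType) n N (u : 'rV[R]_n -> 'rV[R]_N) x :
  Q_infty u x =
    dilation_P (Du u x) *m (\col_i \sum_b \sum_j dilation_P (Du u x) b j * D2 u i j b x)
    + perp_proj (dilation_P (Du u x)) *m (dilation (Du u x) *: dilation_PP_D2 u x).
Proof.
set P := Du u x; apply/colP => a; rewrite !mxE.
under eq_bigr do under eq_bigr do under eq_bigr do rewrite mulrDl.
under eq_bigr do under eq_bigr do rewrite big_split.
under eq_bigr do rewrite big_split.
rewrite big_split/=; congr (_ + _).
  rewrite exchange_big/=; apply: eq_bigr => i _; rewrite mxE mulr_sumr.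
  by apply: eq_bigr => b _; rewrite mulr_sumr; apply: eq_bigr => j _; rewrite mulrA.
have wE c : (dilation P *: dilation_PP_D2 u x) c 0 = dilation P *
    \sum_b \sum_i \sum_j dilation_PP P c i b j * D2 u i j b x by rewrite !mxE.
under [RHS]eq_bigr do rewrite wE !mulr_sumr.
rewrite [RHS]exchange_big/=; apply: eq_bigr => b _.
under [RHS]eq_bigr do rewrite !mulr_sumr.
rewrite [RHS]exchange_big/=; apply: eq_bigr => i _.
under [RHS]eq_bigr do rewrite !mulr_sumr.
rewrite [RHS]exchange_big/=; apply: eq_bigr => j _.
rewrite mulr_sumr mulr_suml; apply: eq_bigr => c _.
by ring.
Qed.

Theorem corollary7p3 (R : realType) (N : nat) (hN : (2 <= N)%N)
    (Omega : set 'rV[R]_2) (u : 'rV[R]_2 -> 'rV[R]_N)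
    (Omega_open : open Omega) (Omega_connected : connected Omega)
    (u_immersion : immersion Omega u) (u_C2 : C2_on Omega u)
    (u_sol : forall x, Omega x -> Q_infty u x = 0) :
  let S x := ahlfors ((Du u x)^T *m Du u x) in
  [/\ (forall x, Omega x -> \rank (S x) = 0%N) \/
      (forall x, Omega x -> \rank (S x) = 2%N),
      (forall x, Omega x -> \rank (S x) = 0%N) ->
        (forall x, Omega x -> dilation (Du u x) = 2) /\
        (forall x, Omega x -> dilation_PP_D2 u x = 0),
      (forall x, Omega x -> dilation (Du u x) = 2) <->
        (forall x, Omega x ->
           (Du u x)^T *m Du u x = (2^-1 * frob_norm (Du u x) ^+ 2)%:M) &
      (forall x, Omega x -> \rank (S x) = 2%N) ->
        (exists c : R, 2 < c /\ forall x, Omega x -> dilation (Du u x) = c) /\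
        (forall x, Omega x -> perp_proj (Du u x) *m dilation_PP_D2 u x = 0)].
Proof.
move=> S.
have rk x : Omega x -> \rank (Du u x) = 2%N by exact: u_immersion.2.
have d0 x : Omega x -> 0 < \det ((Du u x)^T *m Du u x).
  by move=> /rk; exact: det_gram_gt0.
have rS x : \rank (S x) = if S x == 0 then 0%N else 2%N.
  exact/rank_ahlfors/gram_sym.
have split x : Omega x ->
    dilation_P (Du u x) *m (\col_i \sum_b \sum_j dilation_P (Du u x) b j * D2 u i j b x) = 0
    /\ perp_proj (dilation_P (Du u x)) *m dilation_PP_D2 u x = 0.
  move=> Ox; have := u_sol x Ox; rewrite Q_inftyE => /perp_proj_split[-> Kw]; split=> //.
  move: Kw; rewrite -scalemxAr => /eqP; rewrite scaler_eq0 gt_eqF/=; last first.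
    exact/dilation_gt0/d0.
  by move/eqP.
(* The gradient of K(Du) is killed by K_P(Du), which is zero or injective. *)
have grad0 x i : Omega x -> is_derive x (delta_mx 0 i) (fun y => dilation (Du u y) : R) 0.
  move=> Ox; have := is_derive_dilation_Du i Omega_open u_C2 Ox (d0 x Ox).
  set g := \sum_b _; suff -> : g = 0 by [].
  have [S0|S0] := eqVneq (S x) 0.
    rewrite /g dilation_PE ?dilation_grad_eq0; [|exact: S0|exact: d0].
    by rewrite big1// => b _; rewrite big1// => j _; rewrite mxE mul0r.
  have [+ _] := split x Ox; rewrite {1}dilation_PE; last exact: d0.
  move/(dilation_grad_inj (rk x Ox) (elimN eqP S0)) => /colP/(_ i).
  by rewrite !mxE.
have Kcst := connected_derive0_cst Omega_open Omega_connected grad0.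
have K2 x : Omega x -> dilation (Du u x) = 2 <-> S x = 0.
  by move=> /d0; exact: dilation_eq2.
have rS0 x : \rank (S x) = 0%N <-> S x = 0.
  by rewrite rS; case: eqP.
split.
- have [[x0 O0]|nO] := pselect (Omega !=set0); last first.
    by left=> x Ox; case: nO; exists x.
  have [S0|S0] := eqVneq (S x0) 0.
    by left=> x Ox; apply/rS0/K2 => //; rewrite (Kcst x0 x)//; exact/K2.
  right=> x Ox; rewrite rS; case: eqP => [Sx|_]; last by [].
  move/eqP: S0; case; apply/(K2 x0 O0).
  by rewrite (Kcst x x0 Ox O0); exact/(K2 x Ox).
- move=> r0; split=> x Ox; first by apply/K2 => //; exact/rS0/r0.
  have [_] := split x Ox; rewrite dilation_PE; last exact: d0.
  rewrite dilation_grad_eq0; first exact: perp_proj0_eq0.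
  exact/rS0/r0.
- split=> H x Ox.
  + exact/ahlfors_gram_eq0/K2/H.
  + by apply/K2 => //; apply/ahlfors_gram_eq0/H.
- move=> r2; split=> [|x Ox]; last first.
    have [_] := split x Ox; rewrite dilation_PE; last exact: d0.
    rewrite /dilation_grad -mulmxA scalemxAr; exact: perp_proj_mull_eq0.
  have [[x0 O0]|nO] := pselect (Omega !=set0); last first.
    (* On an empty domain any constant above 2 will do. *)
    by exists 3; split=> [|x Ox]; [lra|case: nO; exists x].
  exists (dilation (Du u x0)); split=> [|x Ox]; last exact: Kcst.
  rewrite lt_neqAle dilation_ge2 ?andbT; last exact: d0.
  by apply/eqP => /esym/(K2 x0 O0)/rS0; rewrite r2.
Qed.
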